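(* Let $G$ be a disconnected graph with exactly one nontrivial connected component $G_1$ and $t > 0$ trivial components. Then $h(G\overline{G}) \leq h(G_1) + t$ if $\mathrm{diam}(G_1) \leq 3$, and $h(G\overline{G}) \leq t+2$ if $\mathrm{diam}(G_1) > 3$.
   Context: All graphs are finite, simple and undirected. For a graph $H$ and $x,y \in V(H)$, the closed interval $I[x,y]$ consists of $x$, $y$ and all vertices lying on some shortest path between $x$ and $y$ in $H$; for $S \subseteq V(H)$, $I[S] = \bigcup_{x,y\in S} I[x,y]$. A set $S$ is (geodetically) convex if $I[S]=S$; the convex hull $H(S)$ is the smallest convex set containing $S$; $S$ is a hull set if $H(S)=V(H)$; the (geodetic) hull number $h(H)$ is the minimum cardinality of a hull set of $H$ (so $h(G_1)$ is the hull number of $G_1$ considered as a graph on its own). $\mathrm{diam}$ denotes the diameter. For a graph $G$ with vertex set $\{v_1,\dots,v_n\}$, the complementary prism $G\overline{G}$ has vertex set $\{v_1,\dots,v_n\}\cup\{\overline{v}_1,\dots,\overline{v}_n\}$ and edge set $E(G) \cup \{\overline{v}_i\overline{v}_j : i<j,\ v_iv_j\notin E(G)\} \cup \{v_i\overline{v}_i : 1\le i\le n\}$. A component is trivial if it has exactly one vertex, nontrivial otherwise. *)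

(* Defs.v *)
From mathcomp Require Import all_boot.

Set Implicit Arguments.
Unset Strict Implicit.
Unset Printing Implicit Defensive.

Record sgraph := SGraph {
  svertex :> finType;
  sedge : rel svertex;
  sedge_sym : symmetric sedge;
  sedge_irrefl : irreflexive sedge
}.

Section GraphNotions.
Variable G : sgraph.
Implicit Types (x y z : G) (p : seq G) (S K : {set G}).

Definition walk x y p : bool := path (@sedge G) x p && (last x p == y).

(* The least length of a walk from x to y; by convention it is #|G| when y is
   not reachable from x (otherwise it is less than #|G|). *)
Definition dist x y : nat :=
  find (fun n => [exists p : n.-tuple G, walk x y p]) (iota 0 #|G|).

Definition shortest_path x y p : bool := walk x y p && (size p == dist x y).

(* A maximum of distances; it is the usual diameter for connected G only. *)
Definition diam : nat := \max_(x : G) \max_(y : G) dist x y.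

Definition interval x y : {set G} :=
  [set z | [|| z == x, z == y |
    [exists p : (dist x y).-tuple G, shortest_path x y p && (z \in x :: p)]]].

Definition interval_set S : {set G} :=
  \bigcup_(x in S) \bigcup_(y in S) interval x y.

Definition convex S : bool := interval_set S == S.

Definition convex_hull S : {set G} :=
  \bigcap_(K : {set G} | convex K && (S \subset K)) K.

Definition hull_set S : bool := convex_hull S == [set: G].

Definition hull_number : nat :=
  #|[arg min_(S < [set: G] | hull_set S) #|S| ]|.

Definition connected : bool := [forall x, forall y, connect (@sedge G) x y].

Definition components : {set {set G}} :=
  equivalence_partition (connect (@sedge G)) [set: G].

Definition nontrivial_components : {set {set G}} :=
  [set K in components | 1 < #|K|].

Definition trivial_components : {set {set G}} :=
  [set K in components | #|K| == 1].

End GraphNotions.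

Section Induced.
Variables (G : sgraph) (A : {set G}).

Definition induced_edge : rel {x : G | x \in A} :=
  fun x y => sedge (val x) (val y).

Lemma induced_edge_sym : symmetric induced_edge.
Proof. by move=> x y; apply: sedge_sym. Qed.

Lemma induced_edge_irrefl : irreflexive induced_edge.
Proof. by move=> x; apply: sedge_irrefl. Qed.

Definition induced : sgraph := SGraph induced_edge_sym induced_edge_irrefl.

End Induced.

Section ComplementaryPrism.
Variable G : sgraph.

(* inl x stands for the vertex x of G, inr x for its copy in the complement. *)
Definition prism_edge : rel (G + G)%type := fun u v =>
  match u, v with
  | inl x, inl y => sedge x y
  | inr x, inr y => (x != y) && ~~ sedge x y
  | inl x, inr y | inr x, inl y => x == y
  end.

Lemma prism_edge_sym : symmetric prism_edge.
Proof.
by move=> [x|x] [y|y] /=; rewrite ?(sedge_sym x) ?(eq_sym x).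
Qed.

Lemma prism_edge_irrefl : irreflexive prism_edge.
Proof. by move=> [x|x] /=; rewrite ?sedge_irrefl ?eqxx. Qed.

Definition complementary_prism : sgraph :=
  SGraph prism_edge_sym prism_edge_irrefl.

End ComplementaryPrism.

(* Main.v *)
Require Import Defs.
From mathcomp Require Import all_boot.

(** Let [u] be an isolated vertex of [G].  Its copy in the complement is
    universal there, so [u, u', x', x] (primes denoting copies) is a geodesic of
    the prism for every other vertex [x]; hence a convex set containing [u] and
    [x] contains their copies.

    If [diam G1 <= 3], geodesics of [G1] are geodesics of the prism, because a
    path through the complement has length at least [3].  A hull set of [G1]
    together with the isolated vertices is therefore a hull set.

    If [diam G1 > 3], take a geodesic [a0 a1 a2 a3 a4] of [G1].  The isolated
    vertices together with [a1] and [a3] form a hull set.  The common neighbours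
    of [a1] and [a3] are generated first, among them [a2].  The copies of the two
    ends of an edge are at distance [2], and their common neighbours are the
    copies of the vertices nonadjacent to both ends; so the edges [a1 a2] and
    [a2 a3] generate the copies of [a4] and [a0], and then the edges [a0 a1] and
    [a3 a4] generate the copies of all vertices that are not common neighbours
    of [a1] and [a3].  Finally, if [x'] and [y] are generated and [x y] is an
    edge, then [x], the midpoint of [x' x y], is generated: connectivity
    gives all of [G1]. *)

Set Implicit Arguments.
Unset Strict Implicit.
Unset Printing Implicit Defensive.

(** * Walks, distances and convexity *)

Section Geodesics.
Variable G : sgraph.
Implicit Types (x y z : G) (p q : seq G) (K S : {set G}).

Lemma dist_le_walk x y p : walk x y p -> dist x y <= size p.
Proof.
move=> wp; rewrite leqNgt; apply/negP=> lt_p.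
have := before_find 0 lt_p; rewrite nth_iota; last first.
  by rewrite -(size_iota 0 #|G|); apply: leq_trans lt_p (find_size _ _).
by case/existsP; exists (in_tuple p).
Qed.

Lemma walk_of_dist x y :
  dist x y < #|G| -> exists2 p, walk x y p & size p = dist x y.
Proof.
move=> lt_d; have := lt_d; rewrite -{1}(size_iota 0 #|G|) -has_find.
move/(nth_find 0); rewrite nth_iota // => /existsP[p wp].
by exists p => //; rewrite size_tuple.
Qed.

(** A walk no longer than its own duplicate-free shortening has fewer than [#|G|] edges, so the
    default value of [dist] does not interfere. *)
Lemma dist_minimal_walk x y p :
  walk x y p -> (forall q, walk x y q -> size p <= size q) -> dist x y = size p.
Proof.
move=> wp min_p; apply/eqP; rewrite eqn_leq dist_le_walk //= leqNgt.
apply/negP=> lt_d; have lt_p : size p < #|G|.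
  case/andP: (wp) => pp /eqP; case/shortenP: pp => q pq uq _ lq.
  apply: leq_trans (max_card (mem (x :: q))); rewrite (card_uniqP uq) ltnS.
  by apply: min_p; rewrite /walk pq lq eqxx.
case: (walk_of_dist (ltn_trans lt_d lt_p)) => q wq sq.
by have := min_p q wq; rewrite sq leqNgt lt_d.
Qed.

Lemma convexP K :
  reflect (forall x y p z, x \in K -> y \in K -> shortest_path x y p ->
             z \in p -> z \in K)
          (convex K).
Proof.
apply: (iffP eqP) => [defK x y p z xK yK sp zp | closedK].
  rewrite -defK; apply/bigcupP; exists x => //; apply/bigcupP; exists y => //.
  have sz_p : size p == dist x y by case/andP: sp.
  rewrite inE; apply/or3P/Or33/existsP; exists (Tuple sz_p) => /=.
  by rewrite sp inE zp orbT.
apply/setP=> z; apply/bigcupP/idP=> [[x xK /bigcupP[y yK]] | zK]; last first.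
  by exists z => //; apply/bigcupP; exists z => //; rewrite inE eqxx.
rewrite inE => /or3P[/eqP-> | /eqP-> | /existsP[p /andP[sp]]] //.
by rewrite inE => /predU1P[-> //|]; apply: closedK xK yK sp.
Qed.

(** This lets later arguments exclude shorter walks by cases instead of computing [dist]. *)
Lemma convex_minimal_walk K x y p z :
  convex K -> x \in K -> y \in K -> walk x y p ->
  (forall q, walk x y q -> size p <= size q) -> z \in p -> z \in K.
Proof.
move=> /convexP convK xK yK wp min_p; apply: (convK x y) => //.
by rewrite /shortest_path wp (dist_minimal_walk wp min_p) eqxx.
Qed.

Lemma convex_midpoint K x y z :
  convex K -> x \in K -> y \in K -> x != y -> ~~ sedge x y ->
  sedge x z -> sedge z y -> z \in K.
Proof.
move=> convK xK yK neq_xy nxy xz zy.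
apply: (convex_minimal_walk (p := [:: z; y]) convK xK yK); last first.
- by rewrite mem_head.
- case=> [|a [|b q]] //=; rewrite /walk /= ?andbT.
    by rewrite (negPf neq_xy).
  by case/andP=> xa /eqP ay; rewrite -ay xa in nxy.
by rewrite /walk /= xz zy eqxx.
Qed.

(** * Hull sets and the hull number *)

Lemma hull_setP S :
  reflect (forall K, convex K -> S \subset K -> K = [set: G]) (hull_set S).
Proof.
apply: (iffP eqP) => [hullS K convK sSK | hullS]; apply/setP=> z.
  have: z \in convex_hull S by rewrite hullS inE.
  by move/bigcapP/(_ K); rewrite convK sSK inE => ->.
rewrite [RHS]inE; apply/bigcapP=> K /andP[convK sSK].
by rewrite (hullS K) // inE.
Qed.

Lemma hull_set_setT : hull_set [set: G].
Proof. by apply/hull_setP=> K _; rewrite subTset => /eqP. Qed.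

Lemma hull_number_le S : hull_set S -> hull_number G <= #|S|.
Proof.
move=> hullS; rewrite /hull_number.
by case: arg_minnP => [|T _ minT]; [apply: hull_set_setT | apply: minT].
Qed.

Lemma hull_number_witness :
  exists2 S : {set G}, hull_set S & #|S| = hull_number G.
Proof.
rewrite /hull_number; case: arg_minnP => [|S hullS _]; last by exists S.
exact: hull_set_setT.
Qed.

(** * Diameter *)

Lemma dist_le_diam x y : dist x y <= diam G.
Proof.
apply: leq_trans (leq_bigmax x).
exact: (leq_bigmax (F := fun y => dist x y) y).
Qed.

Lemma diam_gt_exists n : n < diam G -> exists x y, n < dist x y.
Proof.
(* A maximum over an empty type is [0]; since [G] is nonempty, both maxima are attained. *)
move=> lt_n; have cardG : 0 < #|G|.
  apply: contraTT lt_n; rewrite -eqn0Ngt -leqNgt => /eqP/card0_eq G0.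
  by rewrite /diam big_pred0.
have [x dx] := eq_bigmax (fun x => \max_(y : G) dist x y) cardG.
have [y dy] := eq_bigmax (fun y => dist x y) cardG.
by exists x, y; rewrite -dy -dx.
Qed.

(** * Isolated vertices and components *)

Definition isolated x := [set x] \in trivial_components G.

Lemma components_connect K x :
  K \in components G -> x \in K -> K = [set y | connect (@sedge G) x y].
Proof.
case/imsetP=> a _ ->; rewrite !inE => ax; apply/setP=> y; rewrite !inE /=.
by apply: (same_connect _ ax); apply: sym_connect_sym; apply: sedge_sym.
Qed.

Lemma isolated_edge x y : isolated x -> sedge x y = false.
Proof.
rewrite /isolated inE => /andP[compx _]; apply/negP=> xy.
have := connect1 xy; move/setP: (components_connect compx (set11 x)) => /(_ y).
rewrite !inE => <- /eqP yx; by rewrite yx sedge_irrefl in xy.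
Qed.

Lemma card_isolated : #|[set x | isolated x]| <= #|trivial_components G|.
Proof.
rewrite -(card_imset _ set1_inj); apply/subset_leq_card/subsetP=> K.
by case/imsetP=> x; rewrite inE => isox ->.
Qed.

Lemma isolated_exists : 0 < #|trivial_components G| -> exists x, isolated x.
Proof.
case/card_gt0P=> K trivK; have := trivK; rewrite inE => /andP[_ /cards1P[x Kx]].
by exists x; rewrite /isolated -Kx.
Qed.

Lemma isolatedVmem (C : {set G}) x :
  nontrivial_components G = [set C] -> isolated x \/ x \in C.
Proof.
move=> defC; pose K := [set y in [set: G] | connect (@sedge G) x y].
have compK : K \in components G by apply: imset_f.
have xK : x \in K by rewrite !inE connect0.
have [K1 | K_gt1] := leqP #|K| 1; [left | right].
  have /cards1P[z Kz] : #|K| == 1.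
    by rewrite eqn_leq K1 card_gt0; apply/set0Pn; exists x.
  have xz : x = z by apply/set1P; rewrite -Kz.
  by rewrite /isolated xz -Kz inE compK Kz cards1.
suff: K \in [set C] by move/set1P <-.
by rewrite -defC inE compK.
Qed.

End Geodesics.

(** * Closure rules for convex sets of the prism *)

Section PrismClosure.
Variables (G : sgraph) (u : G) (K : {set complementary_prism G}).
Hypotheses (iso_u : isolated u) (convK : convex K) (uK : inl u \in K).
Implicit Types x y z : G.

Lemma prism_pendant_closed x :
  inl x \in K -> x != u -> (inr u \in K) && (inr x \in K).
Proof.
move=> xK neq_xu; pose P := complementary_prism G.
have xu : sedge u x = false := isolated_edge x iso_u.
have mem_p (z : P) : z \in [:: inr u : P; inr x; inl x] -> z \in K.
  apply: (convex_minimal_walk convK uK xK).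
    by rewrite /walk /= (eq_sym u) neq_xu xu !eqxx.
  (* Shorter walks are excluded: from the isolated [u] the only exit is [inr u], whose only
     neighbour in [G] is [inl u]. *)
  case=> [|a [|b [|c q]]] //; rewrite /walk /= ?andbT.
  - by move/eqP=> [] ux; rewrite ux eqxx in neq_xu.
  - by case/andP=> ua /eqP ax; rewrite ax /= xu in ua.
  case: a => a /=; first by rewrite isolated_edge.
  case/andP=> /andP[/eqP ua ab] /eqP bx; rewrite -ua bx /= in ab.
  by rewrite (eqP ab) eqxx in neq_xu.
by rewrite !mem_p // !inE eqxx ?orbT.
Qed.

Lemma prism_inl_closed y z :
  inr z \in K -> inl y \in K -> sedge z y -> inl z \in K.
Proof.
move=> zK yK zy; apply: (convex_midpoint convK zK yK) => //=.
by apply: contraTneq zy => ->; rewrite sedge_irrefl.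
Qed.

Lemma prism_inr_closed x y z :
  inr x \in K -> inr y \in K -> sedge x y ->
  z != x -> z != y -> ~~ sedge x z -> ~~ sedge y z -> inr z \in K.
Proof.
move=> xK yK xy zx zy nxz nyz; have neq_xy : x != y.
  by apply: contraTneq xy => ->; rewrite sedge_irrefl.
apply: (convex_midpoint convK xK yK) => /=.
- by apply: contra neq_xy => /eqP[->].
- by rewrite xy andbF.
- by rewrite eq_sym zx.
by rewrite zy sedge_sym.
Qed.

Lemma prism_common_neighbour_closed x y z :
  inl x \in K -> inl y \in K -> x != y -> ~~ sedge x y ->
  sedge x z -> sedge z y -> inl z \in K.
Proof.
by move=> xK yK neq_xy nxy xz zy; apply: (convex_midpoint convK xK yK).
Qed.

Lemma prism_connect_closed x y :
  (forall z, connect (@sedge G) x z -> inr z \in K) ->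
  inl x \in K -> connect (@sedge G) x y -> inl y \in K.
Proof.
move=> barK xK /connectP[p pp ->].
(* The path is extended at its far end: the last vertex reached lies in [K], and so does the copy of
   the next one. *)
elim/last_ind: p pp => [//|p z IHp]; rewrite rcons_path last_rcons.
case/andP=> pp pz; apply: (prism_inl_closed (y := last x p)); last 2 first.
- exact: IHp.
- by rewrite sedge_sym.
apply: barK; apply: connect_trans (connect1 pz).
by apply/connectP; exists p.
Qed.

End PrismClosure.

(** * Graphs with a single nontrivial component *)

Section OneNontrivialComponent.
Variables (G : sgraph) (C : {set G}).
Hypotheses (C_unique : nontrivial_components G = [set C]).
Hypotheses (t_gt0 : 0 < #|trivial_components G|).

Lemma nontrivial_connect x : x \in C -> C = [set y | connect (@sedge G) x y].
Proof.
have: C \in nontrivial_components G by rewrite C_unique set11.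
by rewrite inE => /andP[compC _]; apply: components_connect.
Qed.

Lemma nontrivial_edge x y : x \in C -> sedge x y -> y \in C.
Proof. by move=> xC xy; rewrite (nontrivial_connect xC) inE connect1. Qed.

Lemma mem_nontrivial_not_isolated x u : x \in C -> isolated u -> x != u.
Proof.
move=> xC iso_u; apply/eqP=> xu; rewrite -{u}xu in iso_u.
have: C \in nontrivial_components G by rewrite C_unique set11.
rewrite inE => /andP[_]; suff -> : C = [set x] by rewrite cards1.
rewrite (nontrivial_connect xC); apply/esym/components_connect; last exact: set11.
by move: iso_u; rewrite /isolated inE => /andP[].
Qed.

(** Pairing an isolated vertex with a vertex of [C] yields the copies of both, so only the vertices
    of [G] need to be generated. *)
Lemma prism_full (K : {set complementary_prism G}) :
  convex K -> (forall u, isolated u -> inl u \in K) ->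
  (exists x, x \in C) -> (forall x, x \in C -> inl x \in K) -> K = [set: _].
Proof.
move=> convK isoK [c cC] CK; apply/setP=> z; rewrite [RHS]inE.
have [u0 iso_u0] := isolated_exists t_gt0.
case: z => x; have [iso_x | xC] := isolatedVmem x C_unique.
- exact: isoK.
- exact: CK.
- have cx := mem_nontrivial_not_isolated cC iso_x.
  by case/andP: (prism_pendant_closed iso_x convK (isoK _ iso_x) (CK c cC) cx).
have xu := mem_nontrivial_not_isolated xC iso_u0.
by case/andP: (prism_pendant_closed iso_u0 convK (isoK _ iso_u0) (CK x xC) xu).
Qed.

Definition prism_seed (A : {set G}) : {set complementary_prism G} :=
  inl @: (A :|: [set x | isolated x]).

Lemma card_prism_seed A :
  #|prism_seed A| <= #|A| + #|trivial_components G|.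
Proof.
apply: leq_trans (leq_imset_card _ _) _.
apply: leq_trans (leq_card_setU _ _) _.
by rewrite leq_add2l card_isolated.
Qed.

Lemma prism_seed_sub A (K : {set complementary_prism G}) :
  prism_seed A \subset K ->
  (forall x, x \in A -> inl x \in K) /\ (forall u, isolated u -> inl u \in K).
Proof.
move/subsetP=> sAK; split=> x Ax; apply/sAK/imset_f; rewrite !inE Ax //.
by rewrite orbT.
Qed.

(** * Small diameter *)

Lemma shortest_path_prism_minimal (x y : induced C) p q :
  shortest_path x y p -> size p <= 3 ->
  walk (inl (val x) : complementary_prism G) (inl (val y)) q ->
  size p <= size q.
Proof.
case/andP=> _ /eqP-> le3; have [q3 _ | ] := leqP 3 (size q).
  exact: leq_trans le3 q3.
case: q => [|a [|b [|c q]]] // _; rewrite /walk /= ?andbT.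
- move/eqP=> [/val_inj->].
  by apply: (@dist_le_walk _ _ _ [::]); rewrite /walk /= eqxx.
- case/andP=> xa /eqP ay; rewrite ay /= in xa.
  by apply: (@dist_le_walk _ _ _ [:: y]); rewrite /walk /= andbT eqxx andbT.
case/andP=> /andP[xa ab] /eqP by_; rewrite {b}by_ in ab.
(* A midpoint in the complement forces [x = y]; a midpoint in [G] lies in [C], so the walk is one of
   [induced C]. *)
case: a xa ab => a /= xa ay; last first.
  have -> : x = y by apply: val_inj; apply: etrans (eqP xa) (eqP ay).
  by apply: leq_trans (@dist_le_walk _ _ _ [::] _) _; rewrite /walk /= ?eqxx.
have aC : a \in C by apply: nontrivial_edge xa; apply: valP.
apply: (@dist_le_walk _ _ _ [:: exist _ a aC : induced C; y]).
by rewrite /walk /= eqxx /induced_edge /= xa ay.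
Qed.

Lemma hull_set_prism_small_diam (S : {set induced C}) :
  diam (induced C) <= 3 -> hull_set S -> hull_set (prism_seed (val @: S)).
Proof.
move=> diam3 /hull_setP hullS; apply/hull_setP=> K convK /prism_seed_sub[SK isoK].
(* The trace of [K] on the component is convex there and contains [S]. *)
pose L : {set induced C} := [set x | inl (val x) \in K].
have L_full : L = setT.
  apply: hullS; last by apply/subsetP=> x xS; rewrite inE SK ?imset_f.
  apply/convexP=> x y p z; rewrite !inE => xK yK sp zp.
  pose f (x : induced C) : complementary_prism G := inl (val x).
  have sz3 : size p <= 3.
    by case/andP: sp => _ /eqP->; apply: leq_trans (dist_le_diam _ _) diam3.
  apply: (convex_minimal_walk (p := map f p) convK xK yK).
  - case/andP: sp => /andP[pp /eqP lp] _.
    by rewrite /walk -/(f x) last_map lp eqxx andbT path_map.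
  - by move=> q; rewrite size_map; apply: shortest_path_prism_minimal.
  exact: map_f zp.
apply: prism_full => //; last first.
  move=> x xC; have: (Sub x xC : induced C) \in L by rewrite L_full inE.
  by rewrite inE.
have: C \in nontrivial_components G by rewrite C_unique set11.
rewrite inE => /andP[_ /ltnW]; by case/card_gt0P=> x xC; exists x.
Qed.

(** * Large diameter *)

Lemma induced_walk (x y : induced C) q :
  walk (val x) (val y) q ->
  exists2 p : seq (induced C), walk x y p & size p = size q.
Proof.
elim: q x => [|a q IHq] x; first by exists [::].
case/andP=> /= /andP[xa pq] lq.
(* Edges of [G] never leave [C], so the walk lifts vertex by vertex. *)
have aC : a \in C by apply: nontrivial_edge xa; apply: valP.
have [|p /andP[pp lp] sz] := IHq (Sub a aC); first by rewrite /walk /= pq.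
by exists (Sub a aC :: p); rewrite /= ?sz // /walk /= pp lp /induced_edge /= xa.
Qed.

Lemma large_diam_path :
  3 < diam (induced C) ->
  exists a0 a1 a2 a3 a4 : G,
    [/\ a0 \in C, path (@sedge G) a0 [:: a1; a2; a3; a4]
      & forall q, walk a0 a4 q -> 3 < size q].
Proof.
case/diam_gt_exists=> x [y dxy].
pose has_walk n := [exists p : n.-tuple G, walk (val x) (val y) p].
have has_walk_size q : walk (val x) (val y) q -> has_walk (size q).
  by move=> wq; apply/existsP; exists (in_tuple q).
have exw : exists n, has_walk n.
  have : connect (@sedge G) (val x) (val y).
    move/setP: (nontrivial_connect (valP x)) => /(_ (val y)).
    by rewrite inE (valP y).
  case/connectP=> p pp lp; exists (size p); apply: has_walk_size.
  by rewrite /walk pp lp eqxx.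
(* A shortest walk is taken in [G] itself; lifting it to [induced C] shows that it has at least four
   edges. *)
case: (ex_minnP exw) => n /existsP[p wp] min_n; have szp := size_tuple p.
have n4 : 3 < n.
  have [q wq] := induced_walk wp; rewrite szp => <-.
  exact: leq_trans dxy (dist_le_walk wq).
case: (tval p) szp wp => [|a1 [|a2 [|a3 [|a4 r]]]] /= szp; try by rewrite -szp in n4.
rewrite /walk /= => /andP[/and5P[xa1 a12 a23 a34 pr] lr].
exists (val x), a1, a2, a3, a4; split; first exact: valP.
  by rewrite /= xa1 a12 a23 a34.
(* Followed by the remainder [r], a walk from [a0] to [a4] with fewer than four edges would beat the
   minimum [n]. *)
move=> q /andP[pq /eqP lq]; have := min_n (size (q ++ r)).
rewrite size_cat -szp -(leq_add2r (size r) 4); apply; rewrite -size_cat.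
by apply: has_walk_size; rewrite /walk cat_path last_cat pq lq pr lr.
Qed.

Lemma hull_set_prism_large_diam a0 a1 a2 a3 a4 :
  a0 \in C -> path (@sedge G) a0 [:: a1; a2; a3; a4] ->
  (forall q, walk a0 a4 q -> 3 < size q) ->
  hull_set (prism_seed [set a1; a3]).
Proof.
move=> a0C /and5P[a01 a12 a23 a34 _] far.
apply/hull_setP=> K convK /prism_seed_sub[AK isoK].
have [u iso_u] := isolated_exists t_gt0.
have a1C := nontrivial_edge a0C a01.
have a1K : inl a1 \in K by rewrite AK // !inE eqxx.
have a3K : inl a3 \in K by rewrite AK // !inE eqxx orbT.
have a2C := nontrivial_edge a1C a12; have a3C := nontrivial_edge a2C a23.
have copyK x : x \in C -> inl x \in K -> inr x \in K.
  move=> xC xK; have xu := mem_nontrivial_not_isolated xC iso_u.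
  by case/andP: (prism_pendant_closed iso_u convK (isoK _ iso_u) xK xu).
have short1 : ~~ sedge a0 a4.
  by apply/negP=> e; have := far [:: a4]; rewrite /walk /= e eqxx => /(_ isT).
have short2 z : sedge a0 z -> ~~ sedge z a4.
  move=> e1; apply/negP=> e2; have := far [:: z; a4].
  by rewrite /walk /= e1 e2 eqxx => /(_ isT).
have short3 z w : sedge a0 z -> sedge z w -> ~~ sedge w a4.
  move=> e1 e2; apply/negP=> e3; have := far [:: z; w; a4].
  by rewrite /walk /= e1 e2 e3 eqxx => /(_ isT).
have sym := @sedge_sym G.
(* Each adjacency excluded here would create a walk of at most three edges from [a0] to [a4]. *)
have n13 : ~~ sedge a1 a3 by apply: contraL a34 => /(short3 _ _ a01).
have n03 : ~~ sedge a0 a3 by apply: contraL a34 => /short2.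
have n02 : ~~ sedge a0 a2 by apply: contraL a34 => /short3; apply.
have n14 := short2 _ a01; have n24 := short3 _ _ a01 a12.
have d13 : a1 != a3 by apply: contraTneq a34 => <-.
have commonK z : sedge a1 z -> sedge z a3 -> inl z \in K.
  by apply: (prism_common_neighbour_closed convK a1K a3K).
have a2K := commonK _ a12 a23.
have b1K := copyK _ a1C a1K; have b2K := copyK _ a2C a2K.
have b3K := copyK _ a3C a3K.
have b4K : inr a4 \in K.
  apply: (prism_inr_closed convK b1K b2K a12) => //.
    by apply: contraNneq short1 => ->.
  by apply: contraNneq n14 => ->.
have b0K : inr a0 \in K.
  apply: (prism_inr_closed convK b2K b3K a23); rewrite // 1?sym //.
    by apply: contraNneq n03 => ->.
  by apply: contraNneq short1 => ->.
have barK z : z \in C -> inr z \in K.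
  move=> zC.
  have [-> //|z0] := eqVneq z a0; have [-> //|z1] := eqVneq z a1.
  have [-> //|z3] := eqVneq z a3; have [-> //|z4] := eqVneq z a4.
  (* Only a vertex adjacent to both edges [a0 a1] and [a3 a4] escapes the rule for copies. Adjacency
     to [a4], or to both [a0] and [a3], would shorten the way from [a0] to [a4], so it is a common
     neighbour of [a1] and [a3]. *)
  have [/orP near01|] := boolP (sedge a0 z || sedge a1 z); last first.
    by rewrite negb_or => /andP[]; apply: (prism_inr_closed convK b0K b1K a01).
  have [/orP near34|] := boolP (sedge a3 z || sedge a4 z); last first.
    by rewrite negb_or => /andP[]; apply: (prism_inr_closed convK b3K b4K a34).
  have z4F : sedge a4 z = false.
    apply/negbTE; rewrite sym; case: near01 => [/short2 // | ].
    exact: short3 a01.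
  have zs3 : sedge z a3 by case: near34; rewrite ?z4F // sym.
  apply: copyK => //; apply: commonK => //.
  by case: near01 => // a0z; have := short3 _ _ a0z zs3; rewrite a34.
apply: prism_full => //; first by exists a0.
move=> x; rewrite (nontrivial_connect a1C) inE.
apply: prism_connect_closed => // z a1z; apply: barK.
by rewrite (nontrivial_connect a1C) inE.
Qed.

End OneNontrivialComponent.

Theorem theorem5 (G : sgraph) (C : {set G}) (t : nat)
    (G_disconnected : ~~ connected G)
    (C_unique : nontrivial_components G = [set C])
    (t_trivial : #|trivial_components G| = t)
    (t_gt0 : 0 < t) :
  (diam (induced C) <= 3 ->
     hull_number (complementary_prism G) <= hull_number (induced C) + t) /\
  (3 < diam (induced C) ->
     hull_number (complementary_prism G) <= t + 2).
Proof.
rewrite -{t}t_trivial in t_gt0 *; split=> [diam3 | diam4].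
  have [S hullS <-] := hull_number_witness (induced C).
  have hullP := hull_set_prism_small_diam C_unique t_gt0 diam3 hullS.
  apply: leq_trans (hull_number_le hullP) _.
  apply: leq_trans (card_prism_seed _) _.
  by rewrite leq_add2r leq_imset_card.
have [a0 [a1 [a2 [a3 [a4 [a0C pa far]]]]]] := large_diam_path C_unique diam4.
have hullP := hull_set_prism_large_diam C_unique t_gt0 a0C pa far.
apply: leq_trans (hull_number_le hullP) _.
apply: leq_trans (card_prism_seed _) _.
by rewrite addnC leq_add2l cards2; case: (_ != _).
Qed.
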